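(* Let $I$ be a countable set, let $(\epsilon_i)_{i\in I}$ be a Bernoulli sequence (i.i.d. symmetric random variables taking values $\pm 1$), and let ${\bf t}=(t_i)_{i\in I}\in \ell^1(I)$. Let $X_{\bf t}=\sum_{i\in I}t_i\epsilon_i$, let $\psi_{\bf t}(s)=\ln E e^{sX_{\bf t}}$ for $s\in\mathbb{R}$, and let $\psi_{\bf t}^*$ be the Cram\'er transform of $X_{\bf t}$, i.e. $\psi_{\bf t}^*(\alpha)=\sup_{s\in\mathbb{R}}\{\alpha s-\psi_{\bf t}(s)\}$ for $\alpha\in\mathbb{R}$. Let $\psi_1:\ell^1(I)\to\mathbb{R}$ be the functional $\psi_1({\bf u})=\ln E e^{X_{\bf u}}$, where $X_{\bf u}=\sum_{i\in I}u_i\epsilon_i$ for ${\bf u}=(u_i)_{i\in I}\in\ell^1(I)$, let $\psi_1^*:\ell_\infty(I)\to\mathbb{R}\cup\{+\infty\}$ be its convex conjugate, and let $\mathcal{D}(\psi_1^* )\subset\ell_\infty(I)$ be the effective domain of $\psi_1^*$. Then $$ \psi_{\bf t}^*(\alpha)=\min_{\substack{{\bf b}\in \mathcal{D}(\psi_1^* ) \\ \sum_{i\in I}t_ib_i=\alpha}}\psi_1^*({\bf b}) $$ for $\alpha\in (-\Vert {\bf t}\Vert_1,\Vert {\bf t}\Vert_1)$ (the minimum being attained), and $\psi_{\bf t}^*(\alpha)=+\infty$ for all other $\alpha\in\mathbb{R}$, where $$ \psi_1^*({\bf b})=\frac{1}{2}\sum_{i\in I}\Big[\big(1+b_i\big)\ln\big(1+b_i\big)+\big(1-b_i\big)\ln\big(1-b_i\big)\Big].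 $$
   Context: $\ell^1(I)$ is the space of real families ${\bf t}=(t_i)_{i\in I}$ with $\Vert {\bf t}\Vert_1=\sum_{i\in I}|t_i|<\infty$. Its dual is identified with $\ell_\infty(I)$, the space of bounded real families, via the pairing $\langle {\bf t},{\bf b}\rangle=\sum_{i\in I}t_ib_i$. For ${\bf t}\in\ell^1(I)$ the series $X_{\bf t}$ converges almost surely and $|X_{\bf t}|\le\Vert{\bf t}\Vert_1$, so $\psi_{\bf t}$ is finite on all of $\mathbb{R}$. For a real locally convex Hausdorff space $X$ with dual $X^*$ and a function $f:X\to\mathbb{R}\cup\{\infty\}$ not identically $\infty$, the effective domain is $\mathcal{D}(f)=\{x\in X: f(x)<\infty\}$ and the convex conjugate (Legendre-Fenchel transform) is $f^*(x^* )=\sup_{x\in X}\{\langle x,x^*\rangle-f(x)\}$ for $x^*\in X^*$. In particular $\psi_1^*({\bf b})=\sup_{{\bf u}\in\ell^1(I)}\{\langle {\bf u},{\bf b}\rangle-\psi_1({\bf u})\}$ for ${\bf b}\in\ell_\infty(I)$, and $\mathcal{D}(\psi_1^* )=\{{\bf b}\in\ell_\infty(I):\psi_1^*({\bf b})<\infty\}$. The Cram\'er transform of a random variable is the Legendre-Fenchel transform of its cumulant generating function. In the explicit formula for $\psi_1^*({\bf b})$, the function $x\mapsto(1+x)\ln(1+x)+(1-x)\ln(1-x)$ is extended by continuity to $[-1,1]$ (value $2\ln 2$ at $x=\pm1$, i.e. $0\ln 0=0$). The value of $\psi_1^*({\bf b})$ is $+\infty$ if $|b_i|>1$ for some $i\in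 I$ or if the series of nonnegative terms diverges.
   Formalization: At the endpoints α = ±‖t‖₁ the value +∞ is claimed only when infinitely many t_i are nonzero; with exactly N nonzero t_i the value there is N ln 2 (e.g. I={1}, t=1, α=1 gives ln 2), so the claim as printed fails in those cases. *)

(* Defs.v *)
From HB Require Import structures.
From mathcomp Require Import all_boot all_order all_algebra.
From mathcomp Require Import all_classical all_reals all_analysis.

Set Implicit Arguments.
Unset Strict Implicit.
Unset Printing Implicit Defensive.

Import Order.TTheory GRing.Theory Num.Theory.
Import numFieldNormedType.Exports.

Local Open Scope classical_set_scope.
Local Open Scope ring_scope.

Section families.
Context {R : realType} {I : choiceType}.
Implicit Types f t b : I -> R.

(* Unordered sum of a real family, as the difference of the sums of its
   positive and negative parts; only meaningful for absolutely summable f. *)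
Definition rsum f : R :=
  fine (\esum_(i in [set: I]) (EFin \o f)^\+ i
        - \esum_(i in [set: I]) (EFin \o f)^\- i)%E.

Definition l1 : set (I -> R) := [set t | summable [set: I] (EFin \o t)].

Definition norm1 t : R := rsum (fun i => `|t i|).

Definition linfty : set (I -> R) := [set b | [bounded b i | i in [set: I]]].

Definition pairing t b : R := rsum (fun i => t i * b i).

End families.

Section convex_analysis.
Context {R : realType} {E F : Type}.

(* Legendre-Fenchel transform of f : D -> \bar R with respect to the pairing
   of D with the dual space; f is extended arbitrarily outside D. *)
Definition conjugate (D : set E) (pair : E -> F -> R) (f : E -> \bar R)
  (y : F) : \bar R :=
  ereal_sup [set ((pair x y)%:E - f x)%E | x in D].

Definition effective_domain (D : set E) (f : E -> \bar R) : set E :=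
  [set x | D x /\ (f x < +oo)%E].

Definition is_minimum (A : set \bar R) (m : \bar R) : Prop :=
  A m /\ lbound A m.

End convex_analysis.

Section probability.
Context {R : realType} {d : measure_display} {T : measurableType d}.
Variable P : probability T R.

Definition mutually_independent {I : choiceType} (X : I -> {RV P >-> R}) :=
  forall (s : seq I) (B : I -> set R), uniq s ->
    (forall i, measurable (B i)) ->
    P (\bigcap_(i in [set` s]) (X i @^-1` B i)) =
    (\prod_(i <- s) P (X i @^-1` B i))%E.

Definition symmetric_sign (X : {RV P >-> R}) : Prop :=
  P (X @^-1` [set 1]) = (2^-1)%:E /\ P (X @^-1` [set -1]) = (2^-1)%:E.

Definition bernoulli_sequence {I : choiceType} (eps : I -> {RV P >-> R}) :=
  mutually_independent eps /\ forall i, symmetric_sign (eps i).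

(* lne is the logarithm on [0, +oo], so an infinite moment generating function
   yields the value +oo. *)
Definition cumulant (X : T -> R) (s : R) : \bar R := lne ('M_P X s).

Definition cramer (X : T -> R) : R -> \bar R :=
  conjugate [set: R] (fun s alpha => alpha * s) (cumulant X).

Context {I : choiceType}.
Variable eps : I -> {RV P >-> R}.

Definition bernoulli_series (t : I -> R) (w : T) : R :=
  rsum (fun i => t i * eps i w).

Definition psi1 (u : I -> R) : \bar R :=
  lne ('E_P[expR \o bernoulli_series u])%E.

Definition psi1_conj : (I -> R) -> \bar R := conjugate l1 pairing psi1.

End probability.

(* The convention 0 ln 0 = 0 is built in, since ln 0 = 0 in the library. *)
Definition entropy_term {R : realType} (x : R) : \bar R :=
  if `|x| <= 1 then ((1 + x) * ln (1 + x) + (1 - x) * ln (1 - x))%:E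
  else +oo%E.

(* Main.v *)
(* For [l1] families [u], independence gives [psi_1 u = sum_i ln cosh u_i], and
   [psi_t s = psi_1 (s t)]. The conjugate of this separable function is computed
   coordinatewise, the conjugate of [ln cosh] being half the entropy function,
   with the supremum of [x b - ln cosh x] attained where [b = tanh x]. Weak
   duality [psi_t^* (<t, b>) <= psi_1^* b] is immediate, and equality holds at
   [b = tanh (s t)], where [s] solves [sum_i t_i tanh (s t_i) = alpha]; this is
   solvable exactly because the left side sweeps [(-||t||_1, ||t||_1)]. *)
Require Import Defs.
From HB Require Import structures.
From mathcomp Require Import all_boot all_order all_algebra finmap.
From mathcomp Require Import all_classical all_reals all_analysis.
From mathcomp Require Import measurable_realfun lra.

Set Implicit Arguments.
Unset Strict Implicit.
Unset Printing Implicit Defensive.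

Import Order.TTheory GRing.Theory Num.Theory.
Import numFieldNormedType.Exports.

Local Open Scope classical_set_scope.
Local Open Scope ring_scope.

(** * Unordered sums of real families *)

Section unordered_sums.
Context {R : realType} {I : choiceType}.
Implicit Types (f g u : I -> R) (F : {fset I}).

(** Convergence along the finite subsets directed by inclusion. Linearity and monotonicity are
    direct estimates in this form, and [sums_to_rsum] carries them over to [rsum]. *)
Definition sums_to f (l : R) : Prop := forall e : R, 0 < e ->
  exists F0 : {fset I}, forall F, (F0 `<=` F)%fset ->
    `|\sum_(i <- F) f i - l| <= e.

Lemma big_fset_sub f F0 F : (F0 `<=` F)%fset ->
  \sum_(i <- F | i \in F0) f i = \sum_(i <- F0) f i.
Proof.
move=> F0F; rewrite -big_filter; apply: perm_big; apply: uniq_perm.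
- by rewrite filter_uniq ?fset_uniq.
- exact: fset_uniq.
move=> i; rewrite mem_filter; case: (boolP (i \in F0)) => //= iF0.
exact: (fsubsetP F0F).
Qed.

Lemma ler_sum_fset f F0 F : (forall i, 0 <= f i) -> (F0 `<=` F)%fset ->
  \sum_(i <- F0) f i <= \sum_(i <- F) f i.
Proof.
move=> f0 F0F; rewrite [leRHS](bigID (mem F0)) /= big_fset_sub // lerDl.
by apply: sumr_ge0.
Qed.

Lemma sum_fset_le_esum f F : (forall i, 0 <= f i) ->
  ((\sum_(i <- F) f i)%:E <= \esum_(i in [set: I]) (f i)%:E)%E.
Proof.
move=> f0; apply: ereal_sup_ubound; exists [set` F] => //=.
by rewrite fsbig_finite //= set_fsetK -sumEFin.
Qed.

Lemma esum_approx f (r : R) : (r%:E < \esum_(i in [set: I]) (f i)%:E)%E ->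
  exists F, r < \sum_(i <- F) f i.
Proof.
move=> /ereal_sup_gt[_ [A [finA _] <-]].
rewrite fsbig_finite //= sumEFin lte_fin => rA.
by exists (fset_set A).
Qed.

(** The supremum defining the sum is approached by one finite set, hence by all larger ones, since
    the partial sums increase. *)
Lemma sums_to_esum f : (forall i, 0 <= f i) ->
  (\esum_(i in [set: I]) (f i)%:E < +oo)%E ->
  sums_to f (fine (\esum_(i in [set: I]) (f i)%:E)).
Proof.
move=> f0 foo e e0.
have fin : (\esum_(i in [set: I]) (f i)%:E)%E \is a fin_num.
  by rewrite ge0_fin_numE // esum_ge0 // => i _; rewrite lee_fin.
have [F0 F0e] : exists F0,
    fine (\esum_(i in [set: I]) (f i)%:E) - e < \sum_(i <- F0) f i.
  by apply: esum_approx; rewrite -[ltRHS]fineK // lte_fin ltrBlDr ltrDl.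
exists F0 => F /(ler_sum_fset f0) F0F.
have := sum_fset_le_esum F f0; rewrite -(fineK fin) lee_fin /= => Fle.
by rewrite ler_norml; apply/andP; split; lra.
Qed.

Lemma sums_toD f g l m : sums_to f l -> sums_to g m ->
  sums_to (fun i => f i + g i) (l + m).
Proof.
move=> fl gm e e0; have e2 : 0 < e / 2 by rewrite divr_gt0.
have [F Fe] := fl _ e2; have [G Ge] := gm _ e2.
exists (F `|` G)%fset => H; rewrite fsubUset => /andP[/Fe Hf /Ge Hg].
rewrite big_split /=.
rewrite [X in `|X|](_ : _ = (\sum_(i <- H) f i - l) +
  (\sum_(i <- H) g i - m)); last by lra.
by rewrite (le_trans (ler_normD _ _)) //; lra.
Qed.

Lemma sums_toZ f l (c : R) : sums_to f l -> sums_to (fun i => c * f i) (c * l).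
Proof.
move=> fl e e0; have c0 : 0 < `|c| + 1 by rewrite ltr_wpDl.
have [F Fe] := fl (e / (`|c| + 1)) (divr_gt0 e0 c0).
exists F => G /Fe Ge; rewrite -mulr_sumr -mulrBr normrM.
apply: (@le_trans _ _ ((`|c| + 1) * (e / (`|c| + 1)))).
  by apply: ler_pM => //; rewrite lerDl.
by rewrite mulrC divfK // gt_eqF.
Qed.

Lemma sums_toB f g l m : sums_to f l -> sums_to g m ->
  sums_to (fun i => f i - g i) (l - m).
Proof.
move=> fl /(sums_toZ (-1)) gm; have := sums_toD fl gm.
rewrite mulN1r (_ : (fun i => f i + _) = (fun i => f i - g i)) //.
by apply/funext => i; rewrite mulN1r.
Qed.

Lemma sums_to_le f g l m : (forall i, f i <= g i) -> sums_to f l ->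
  sums_to g m -> l <= m.
Proof.
move=> fg fl gm; apply/ler_addgt0Pr => e e0.
have e2 : 0 < e / 2 by rewrite divr_gt0.
have [F Fe] := fl _ e2; have [G Ge] := gm _ e2.
have := Fe (F `|` G)%fset (fsubsetUl _ _).
have := Ge (F `|` G)%fset (fsubsetUr _ _).
have : \sum_(i <- (F `|` G)%fset) f i <= \sum_(i <- (F `|` G)%fset) g i.
  by apply: ler_sum.
by rewrite !ler_norml => ? /andP[? ?] /andP[? ?]; lra.
Qed.

Lemma sums_to_unique f l m : sums_to f l -> sums_to f m -> l = m.
Proof.
by move=> fl fm; apply/eqP; rewrite eq_le !(@sums_to_le f f).
Qed.

Lemma sums_to_fin f F : (forall i, i \notin F -> f i = 0) ->
  sums_to f (\sum_(i <- F) f i).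
Proof.
move=> fF e e0; exists F => G FG.
rewrite (bigID (mem F)) /= big_fset_sub // [X in _ + X - _]big1 => [|i /fF //].
by rewrite addr0 subrr normr0 ltW.
Qed.

Lemma sum_fset_le_sums_to f l F : (forall i, 0 <= f i) -> sums_to f l ->
  \sum_(i <- F) f i <= l.
Proof.
move=> f0 fl; pose g i := if i \in F then f i else 0.
have -> : \sum_(i <- F) f i = \sum_(i <- F) g i.
  by apply: eq_big_seq => i iF; rewrite /g iF.
apply: (@sums_to_le g f) => //.
- by move=> i; rewrite /g; case: ifP.
- by apply: sums_to_fin => i; rewrite /g => /negbTE ->.
Qed.

Lemma l1_le f g : (forall i, `|f i| <= `|g i|) -> l1 g -> l1 f.
Proof.
move=> fg; apply: le_lt_trans; apply: le_esum => i _.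
by rewrite /= lee_fin.
Qed.

(** The limit bounds every partial sum of a nonnegative family. Closure properties of [l1] are
    obtained from those of [sums_to] in this way. *)
Lemma sums_to_ge0_l1 f l : (forall i, 0 <= f i) -> sums_to f l -> l1 f.
Proof.
move=> f0 fl; rewrite /l1 /summable /=.
apply: (@le_lt_trans _ _ l%:E); last by rewrite ltry.
apply: ge_ereal_sup => _ [A [finA _] <-]; rewrite fsbig_finite //=.
rewrite sumEFin lee_fin (eq_bigr f) => [|i _]; last by rewrite ger0_norm.
exact: sum_fset_le_sums_to.
Qed.

(** The positive and negative parts are dominated by the absolute value, so both extended sums are
    finite and [fine] commutes with their difference. *)
Lemma sums_to_rsum f : l1 f -> sums_to f (rsum f).
Proof.
move=> f1.
have part g : (forall i, 0 <= g i <= `|f i|) ->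
    (\esum_(i in [set: I]) (g i)%:E \is a fin_num)%E /\
    sums_to g (fine (\esum_(i in [set: I]) (g i)%:E)).
  move=> gf; have g0 i : 0 <= g i by have /andP[] := gf i.
  have goo : (\esum_(i in [set: I]) (g i)%:E < +oo)%E.
    apply: le_lt_trans f1; apply: le_esum => i _; rewrite /= lee_fin.
    by have /andP[] := gf i.
  split; last exact: sums_to_esum.
  by rewrite ge0_fin_numE // esum_ge0 // => i _; rewrite lee_fin.
have [] := part (fun i => Num.max (f i) 0).
  by move=> i; rewrite le_max lexx orbT ge_max ler_norm normr_ge0.
move=> pfin psum; have [] := part (fun i => Num.max (- f i) 0).
  by move=> i; rewrite le_max lexx orbT ge_max -normrN ler_norm normr_ge0.
move=> nfin nsum; have := sums_toB psum nsum.
rewrite -fineB // (_ : (fun i => _) = f); last first.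
  by apply/funext => i; rewrite /Num.max; do 2 case: ltP => ?; lra.
congr sums_to; rewrite /rsum; congr fine; congr (_ - _)%E.
  by apply: eq_esum => i _; rewrite funeposE /= EFin_max.
by apply: eq_esum => i _; rewrite funenegE /= EFin_max.
Qed.

Lemma rsum_sums_to f l : l1 f -> sums_to f l -> rsum f = l.
Proof. by move=> /sums_to_rsum; exact: sums_to_unique. Qed.

Lemma l1_fin f F : (forall i, i \notin F -> f i = 0) -> l1 f.
Proof.
move=> fF; apply: (@l1_le f (fun i => `|f i|)).
  by move=> i; rewrite normr_id.
apply: (@sums_to_ge0_l1 _ (\sum_(i <- F) `|f i|)) => //.
by apply: sums_to_fin => i /fF ->; rewrite normr0.
Qed.

Lemma rsum_fin f F : (forall i, i \notin F -> f i = 0) ->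
  rsum f = \sum_(i <- F) f i.
Proof.
by move=> fF; apply: rsum_sums_to; [exact: l1_fin fF|exact: sums_to_fin].
Qed.

Lemma l1_norm f : l1 f -> l1 (fun i => `|f i|).
Proof. by apply: l1_le => i; rewrite normr_id. Qed.

Lemma l1Z f (c : R) : l1 f -> l1 (fun i => c * f i).
Proof.
move=> /l1_norm/sums_to_rsum/(sums_toZ `|c|) cf.
have cf0 i : 0 <= `|c| * `|f i| by rewrite mulr_ge0.
by apply: l1_le (sums_to_ge0_l1 cf0 cf) => i; rewrite !normrM !normr_id.
Qed.

Lemma rsumZ f (c : R) : l1 f -> rsum (fun i => c * f i) = c * rsum f.
Proof.
move=> f1; apply: rsum_sums_to; first exact: l1Z.
exact/sums_toZ/sums_to_rsum.
Qed.

Lemma ler_rsum f g : l1 f -> l1 g -> (forall i, f i <= g i) ->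
  rsum f <= rsum g.
Proof.
by move=> /sums_to_rsum f1 /sums_to_rsum g1 fg; exact: sums_to_le fg f1 g1.
Qed.

Lemma l1D f g : l1 f -> l1 g -> l1 (fun i => f i + g i).
Proof.
move=> /l1_norm/sums_to_rsum f1 /l1_norm/sums_to_rsum g1.
have fg0 i : 0 <= `|f i| + `|g i| by rewrite addr_ge0.
apply: l1_le (sums_to_ge0_l1 fg0 (sums_toD f1 g1)) => i.
by rewrite [leRHS]ger0_norm ?ler_normD.
Qed.

Lemma l1B f g : l1 f -> l1 g -> l1 (fun i => f i - g i).
Proof.
move=> f1 g1; have := l1D f1 (l1Z (-1) g1).
by congr l1; apply/funext => i; rewrite mulN1r.
Qed.

Lemma rsumB f g : l1 f -> l1 g ->
  rsum (fun i => f i - g i) = rsum f - rsum g.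
Proof.
move=> f1 g1; apply: rsum_sums_to; first exact: l1B.
by apply: sums_toB; exact: sums_to_rsum.
Qed.

Lemma sum_fset_le_rsum f F : l1 f -> (forall i, 0 <= f i) ->
  \sum_(i <- F) f i <= rsum f.
Proof. by move=> /sums_to_rsum f1 f0; exact: sum_fset_le_sums_to. Qed.

Lemma rsum_approx f (e : R) : l1 f -> 0 < e ->
  exists F, rsum f <= \sum_(i <- F) f i + e.
Proof.
move=> /sums_to_rsum f1 /f1[F /(_ F (fsubset_refl F))].
by rewrite ler_norml => /andP[? _]; exists F; lra.
Qed.

Lemma ler_norm_rsum f : l1 f -> `|rsum f| <= norm1 f.
Proof.
move=> f1; have n1 := l1_norm f1; rewrite ler_norml; apply/andP; split.
  rewrite -mulN1r -rsumZ //; apply: ler_rsum => // [|i]; first exact: l1Z.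
  by rewrite mulN1r lerNl -normrN ler_norm.
by apply: ler_rsum => // i; exact: ler_norm.
Qed.

(** The error is the sum of [f] outside [F], bounded by the absolute sum there. This bound depends
    on the absolute values alone, so it is uniform over choices of signs. *)
Lemma dist_rsum_fset f F : l1 f ->
  `|rsum f - \sum_(i <- F) f i| <= norm1 f - \sum_(i <- F) `|f i|.
Proof.
move=> f1.
have restr (h : I -> R) :
    \sum_(i <- F) h i = rsum (fun i => if i \in F then h i else 0).
  rewrite (@rsum_fin _ F) => [|i /negbTE -> //].
  by apply: eq_big_seq => i ->.
have l1_restr (h : I -> R) : l1 (fun i => if i \in F then h i else 0).
  by apply: (@l1_fin _ F) => i /negbTE ->.
rewrite !restr /norm1 -!rsumB //; last exact: l1_norm.
apply: le_trans (ler_norm_rsum (l1B f1 (l1_restr f))) _.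
rewrite /norm1 (_ : (fun i => `|_|) =
  (fun i => `|f i| - (if i \in F then `|f i| else 0))) //.
by apply/funext => i; case: ifP => _; rewrite ?subr0 // !subrr normr0.
Qed.

End unordered_sums.

(** * Log-cosh, its conjugate the entropy function, and the hyperbolic tangent *)

Section hyperbolic_functions.
Context {R : realType}.
Implicit Types x y b e : R.

Definition coshR x : R := (expR x + expR (- x)) / 2.

Definition lncosh x : R := ln (coshR x).

(** The hyperbolic tangent with a single reciprocal, to which its bounds and its Lipschitz estimate
    reduce. *)
Definition tanhR x : R := 1 - 2 / (expR (2 * x) + 1).

Definition entropy b : R := (1 + b) * ln (1 + b) + (1 - b) * ln (1 - b).

Lemma coshR_ge1 x : 1 <= coshR x.
Proof.
have := expR_ge1Dx x; have := expR_ge1Dx (- x).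
by rewrite /coshR => ? ?; lra.
Qed.

Lemma coshR_gt0 x : 0 < coshR x.
Proof. exact: lt_le_trans (coshR_ge1 x). Qed.

Lemma coshRN x : coshR (- x) = coshR x.
Proof. by rewrite /coshR opprK addrC. Qed.

Lemma lncosh_ge0 x : 0 <= lncosh x.
Proof. exact: ln_ge0 (coshR_ge1 x). Qed.

Lemma lncoshN x : lncosh (- x) = lncosh x.
Proof. by rewrite /lncosh coshRN. Qed.

Lemma lncosh_norm x : lncosh `|x| = lncosh x.
Proof. by case: (ger0P x) => // _; rewrite lncoshN. Qed.

Lemma lncosh0 : lncosh 0 = 0.
Proof. by rewrite /lncosh /coshR oppr0 expR0 divff ?ln1. Qed.

Lemma lncosh_le x : lncosh x <= `|x|.
Proof.
rewrite -lncosh_norm -[leRHS]expRK ler_ln ?posrE ?coshR_gt0 ?expR_gt0 //.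
have : expR (- `|x|) <= expR `|x|.
  by rewrite ler_expR (le_trans _ (normr_ge0 x)) // oppr_le0.
by rewrite /coshR => ?; lra.
Qed.

(** With [q = e^(-2y)], the right side is [ln 2 - ln (1 + q)], and
    [ln (1 + q) <= q <= 1 / (1 + 2y)]. This gives a rate for the limit [ln 2] at infinity, used at
    the endpoints [|b| = 1] and [|alpha| = ||t||_1]. *)
Lemma sub_lncosh_ge y : 0 <= y -> ln 2 - (1 + 2 * y)^-1 <= y - lncosh y.
Proof.
move=> y0; have y1 : 0 < 1 + 2 * y by lra.
set q := expR (- (2 * y)).
have q0 : 0 < q := expR_gt0 _.
have -> : lncosh y = y + ln (1 + q) - ln 2.
  rewrite /lncosh (_ : coshR y = expR y * (1 + q) / 2).
    rewrite ln_div ?lnM ?expRK // posrE ?mulr_gt0 ?expR_gt0 //; lra.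
  rewrite /coshR mulrDr mulr1 -expRD; congr ((_ + expR _) / 2); lra.
have : ln (1 + q) <= q by apply: le_ln1Dx; lra.
have : q <= (1 + 2 * y)^-1.
  by rewrite /q expRN lef_pV2 ?posrE ?expR_gt0 // expR_ge1Dx.
by move=> ? ?; lra.
Qed.

Lemma ln_le_sub1 y : 0 < y -> ln y <= y - 1.
Proof.
move=> y0; have := @le_ln1Dx R (y - 1); rewrite (addrC 1) subrK; apply.
by rewrite ltrBrDr addrC subrr.
Qed.

Lemma ln2_ge : 2^-1 <= ln 2 :> R.
Proof.
have : ln (2^-1) <= 2^-1 - 1 :> R by apply: ln_le_sub1; rewrite invr_gt0.
by rewrite lnV ?posrE //; lra.
Qed.

(** This is [ln (y / x) <= y / x - 1] multiplied by [x]. The case [x = 0] is included because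
    [1 + b] or [1 - b] may vanish. *)
Lemma gibbs x y : 0 <= x -> 0 < y -> x * (ln y - ln x) <= y - x.
Proof.
rewrite le_eqVlt => /predU1P[<- y0|x0 y0]; first by rewrite mul0r subr0 ltW.
rewrite -ln_div ?posrE //.
have := ln_le_sub1 (divr_gt0 y0 x0) => /(ler_wpM2l (ltW x0))/le_trans; apply.
by rewrite mulrBr mulr1 mulrC divfK // gt_eqF.
Qed.

(* Gibbs' inequality for the weights [1 + b], [1 - b] against the tilted
   weights [e^x / cosh x], [e^-x / cosh x], both of total mass 2. *)
Lemma lncosh_entropy x b : `|b| <= 1 -> x * b - lncosh x <= entropy b / 2.
Proof.
rewrite ler_norml => /andP[b1 b2]; have C0 := coshR_gt0 x.
have mass : expR x / coshR x + expR (- x) / coshR x = 2.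
  rewrite -mulrDl -[X in X / _](@divfK _ 2) // -/(coshR x).
  by rewrite mulrAC divff ?mul1r // gt_eqF.
have ln_tilt z : ln (expR z / coshR x) = z - lncosh x.
  by rewrite ln_div ?posrE ?expR_gt0 // expRK.
have tilt_gt0 z : 0 < expR z / coshR x by rewrite divr_gt0 ?expR_gt0.
have := @gibbs (1 + b) _ (ltac:(lra)) (tilt_gt0 x).
have := @gibbs (1 - b) _ (ltac:(lra)) (tilt_gt0 (- x)).
by rewrite !ln_tilt /entropy => ? ?; lra.
Qed.

Lemma tanhR_lt1 x : `|tanhR x| < 1.
Proof.
have E0 : 0 < expR (2 * x) := expR_gt0 _.
rewrite /tanhR ltr_norml.
have : 0 < 2 / (expR (2 * x) + 1) by rewrite divr_gt0 //; lra.
have : 2 / (expR (2 * x) + 1) < 2 by rewrite ltr_pdivrMr; lra.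
by move=> ? ?; apply/andP; split; lra.
Qed.

(** For [b = tanh x] the weight [1 + b] is exactly the tilted weight of [lncosh_entropy]; with the
    companion identity for [1 - b], this is the equality case there. *)
Lemma add1_tanhR x : 1 + tanhR x = expR x / coshR x.
Proof.
have E0 := expR_gt0 x; have F0 := expR_gt0 (- x).
apply: (@mulIf _ (coshR x)); first by rewrite gt_eqF ?coshR_gt0.
rewrite divfK ?gt_eqF ?coshR_gt0 // /tanhR.
have -> : coshR x = expR (- x) * (expR (2 * x) + 1) / 2.
  rewrite /coshR mulrDr mulr1 -expRD; congr ((expR _ + _) / 2); lra.
have -> : expR x = expR (- x) * expR (2 * x).
  by rewrite -expRD; congr expR; lra.
have : expR (2 * x) + 1 != 0 by rewrite gt_eqF // addr_gt0 ?expR_gt0.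
move=> /divff; set D := _ + 1; rewrite /D => DD; nra.
Qed.

Lemma sub1_tanhR x : 1 - tanhR x = expR (- x) / coshR x.
Proof.
have C0 : coshR x != 0 by rewrite gt_eqF ?coshR_gt0.
have -> : 1 - tanhR x = 2 - (1 + tanhR x) by lra.
rewrite add1_tanhR; apply: (@mulIf _ (coshR x)) => //.
by rewrite mulrBl !divfK // /coshR; lra.
Qed.

Lemma tanhRN x : tanhR (- x) = - tanhR x.
Proof. by have := sub1_tanhR (- x); rewrite coshRN opprK -add1_tanhR; lra. Qed.

Lemma entropy_tanhR x : entropy (tanhR x) / 2 = x * tanhR x - lncosh x.
Proof.
have ln_tilt z : ln (expR z / coshR x) = z - lncosh x.
  by rewrite ln_div ?posrE ?expR_gt0 ?coshR_gt0 // expRK.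
by rewrite /entropy add1_tanhR sub1_tanhR !ln_tilt -add1_tanhR -sub1_tanhR; lra.
Qed.

Lemma tanhR_surj b : `|b| < 1 -> exists x, tanhR x = b.
Proof.
(* The witness is the inverse hyperbolic tangent of [b]. *)
rewrite ltr_norml => /andP[b1 b2]; exists (ln ((1 + b) / (1 - b)) / 2).
have p0 : 0 < 1 - b by lra.
have q0 : 0 < 1 + b by lra.
rewrite /tanhR [2 * (_ / _)]mulrC divfK // lnK ?posrE ?divr_gt0 //.
have -> : (1 + b) / (1 - b) + 1 = 2 / (1 - b).
  by apply: (@mulIf _ (1 - b)); rewrite ?mulrDl ?divfK ?gt_eqF //; lra.
rewrite invf_div [2 * (_ / _)]mulrC divfK //; lra.
Qed.

(** For [|b| < 1] the supremum is attained where [tanh x = b]; for [|b| = 1] it equals [ln 2] and is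
    only approached as [x b] tends to infinity. *)
Lemma entropy_approx b e : `|b| <= 1 -> 0 < e ->
  exists x, entropy b / 2 - e <= x * b - lncosh x.
Proof.
move=> b1 e0; have [blt|bge] := ltP `|b| 1.
  by have [x <-] := tanhR_surj blt; exists x; rewrite entropy_tanhR; lra.
have {b1 bge} b1 : `|b| = 1 by apply/eqP; rewrite eq_le b1.
have -> : entropy b / 2 = ln 2.
  have n2 : 1 + 1 = 2 :> R by [].
  move: b1; case: (ger0P b) => _ b1.
    by rewrite /entropy b1 subrr mul0r n2; lra.
  have -> : b = -1 by lra.
  by rewrite /entropy subrr mul0r opprK n2; lra.
(* Here [x b = |x| = 1 / e], and the error [1 / (1 + 2 / e)] from [sub_lncosh_ge] is at most [e]. *)
exists (e^-1 * b).
rewrite -lncosh_norm normrM b1 mulr1 -mulrA -expr2 -real_normK ?num_real // b1.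
rewrite expr1n mulr1; have i0 : 0 < e^-1 by rewrite invr_gt0.
rewrite gtr0_norm //; apply: le_trans (sub_lncosh_ge (ltW i0)).
rewrite lerB // -[leRHS]invrK lef_pV2 ?posrE //; lra.
Qed.

Lemma entropy_ge0 b : `|b| <= 1 -> 0 <= entropy b.
Proof. by move=> /(lncosh_entropy 0); rewrite lncosh0 mul0r; lra. Qed.

(** By [entropy_tanhR] the product is half an entropy plus [lncosh x], both nonnegative. *)
Lemma mul_tanhR_ge0 x : 0 <= x * tanhR x.
Proof.
have := entropy_tanhR x; have := entropy_ge0 (ltW (tanhR_lt1 x)).
by have := lncosh_ge0 x; lra.
Qed.

(** For [y <= x], with [A = e^(2x)] and [B = e^(2y)], the difference is
    [2 (A - B) / ((A + 1) (B + 1))], and [e^z >= 1 + z] yields [A - B <= 2 A (x - y)]. The constant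
    is crude; it serves only continuity. *)
Lemma tanhR_lipschitz x y : `|tanhR x - tanhR y| <= 4 * `|x - y|.
Proof.
wlog yx : x y / y <= x.
  by move=> H; have [/H //|/ltW/H] := leP y x; rewrite distrC (distrC y).
have -> : tanhR x - tanhR y =
    2 * ((expR (2 * y) + 1)^-1 - (expR (2 * x) + 1)^-1).
  by rewrite /tanhR; lra.
set A := expR (2 * x); set B := expR (2 * y).
have A0 : 0 < A := expR_gt0 _.
have B0 : 0 < B := expR_gt0 _.
have BA : B <= A by rewrite ler_expR; lra.
have AB : A - B <= 2 * A * (x - y).
  have : A * (1 + 2 * (y - x)) <= A * expR (2 * (y - x)).
    by rewrite ler_pM2l ?expR_ge1Dx.
  rewrite -expRD (_ : 2 * x + _ = 2 * y) -/B; lra.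
have -> : (B + 1)^-1 - (A + 1)^-1 = (A - B) / ((A + 1) * (B + 1)).
  apply: (@mulIf _ ((A + 1) * (B + 1))).
    by rewrite mulf_neq0 // gt_eqF // addr_gt0.
  rewrite divfK; last by rewrite mulf_neq0 // gt_eqF // addr_gt0.
  rewrite mulrBl [X in _ - X]mulrA mulVf ?mul1r; last first.
    by rewrite gt_eqF // addr_gt0.
  rewrite (mulrC (A + 1)) mulrA mulVf ?mul1r; last first.
    by rewrite gt_eqF // addr_gt0.
  lra.
have D0 : 0 < (A + 1) * (B + 1) by rewrite mulr_gt0 // addr_gt0.
rewrite !ger0_norm ?subr_ge0 //; last first.
  by rewrite mulr_ge0 // divr_ge0 ?subr_ge0 // ltW.
have : (A - B) / ((A + 1) * (B + 1)) <= 2 * (x - y).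
  rewrite ler_pdivrMr //; nra.
by lra.
Qed.

(** By parity take [t >= 0]: the loss is [2 t / (e^(2st) + 1) <= t / (1 + s t) <= 1 / s], uniformly
    in [t]. *)
Lemma mul_tanhR_ge (s t : R) : 0 < s -> `|t| - s^-1 <= t * tanhR (s * t).
Proof.
move=> s0; suff H u : 0 <= u -> u - s^-1 <= u * tanhR (s * u).
  case: (ger0P t) => [/H //|/ltW t0]; have := H (- t).
  by rewrite oppr_ge0 mulrN tanhRN mulrNN; apply.
move=> u0; have w0 : 0 <= s * u by rewrite mulr_ge0 // ltW.
rewrite /tanhR mulrBr mulr1 lerB //.
have : 2 / (expR (2 * (s * u)) + 1) <= (1 + s * u)^-1.
  have := expR_ge1Dx (2 * (s * u)) => E.
  by rewrite -invf_div lef_pV2 ?posrE; lra.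
move=> /(ler_wpM2l u0)/le_trans; apply.
rewrite ler_pdivrMr; last lra.
rewrite mulrDr mulr1 mulrA mulVf ?gt_eqF // mul1r lerDr invr_ge0; lra.
Qed.

End hyperbolic_functions.

(** * Measurability of sums over a countable index set *)

Section measurability_of_sums.
Context {R : realType} {d : measure_display} {T : measurableType d}.
Context {I : countType}.

(** Countability of [I] enters here: coding indices by naturals turns the unordered sum into a
    series, padded with zeros at naturals that code no index. *)
Lemma measurable_esum (a : I -> T -> \bar R) :
  (forall i w, (0 <= a i w)%E) ->
  (forall i, measurable_fun [set: T] (a i)) ->
  measurable_fun [set: T] (fun w => \esum_(i in [set: I]) a i w)%E.
Proof.
move=> a0 ma.
pose g n w : \bar R := if pickle_inv n is Some i then a i w else 0%E.
have g0 n w : (0 <= g n w)%E by rewrite /g; case: pickle_inv.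
rewrite (_ : (fun w => _) = (fun w => \sum_(n <oo) g n w)%E).
  apply: (@ge0_emeasurable_sum _ _ _ _ _ predT) => // n _.
  by rewrite /g; case: pickle_inv => // i; exact: ma.
apply/funext => w; rewrite nneseries_esumT //.
have -> : (\esum_(n in [set: nat]) g n w =
    \esum_(n in range (choice.pickle : I -> nat)) g n w)%E.
  rewrite [RHS]esum_mkcond; apply: eq_esum => n _.
  case: ifPn => //; rewrite notin_setE /g => nn.
  case E : (pickle_inv n) => [i|//]; exfalso; apply: nn; exists i => //.
  by have := @choice.pickle_invK I n; rewrite E.
rewrite (@reindex_esum _ _ _ [set: I]%classic _ choice.pickle); last first.
  by apply: inj_bij; apply: in2W; exact: (pcan_inj (@choice.pickleK I)).
by apply: eq_esum => i _; rewrite /g pickleK_inv.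
Qed.

Lemma measurable_rsum (f : I -> T -> R) :
  (forall i, measurable_fun [set: T] (f i)) ->
  measurable_fun [set: T] (fun w => rsum (fun i => f i w)).
Proof.
move=> mf; apply: measurableT_comp => //.
apply: emeasurable_funB; apply: measurable_esum => [i w|i] //.
  rewrite (_ : (fun w => _) = (EFin \o f i)^\+)%E; first last.
    by apply/funext => w; rewrite !funeposE.
  exact/measurable_funepos/measurable_EFinP.
rewrite (_ : (fun w => _) = (EFin \o f i)^\-)%E; first last.
  by apply/funext => w; rewrite !funenegE.
exact/measurable_funeneg/measurable_EFinP.
Qed.

End measurability_of_sums.

(** * Cumulant generating functions of Bernoulli series *)

Section bernoulli.
Context {R : realType} {d : measure_display} {T : measurableType d}.
Context {P : probability T R} {I : countType} {eps : I -> {RV P >-> R}}.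
Hypothesis heps : bernoulli_sequence eps.

Let plus i : set T := eps i @^-1` [set 1].
Let minus i : set T := eps i @^-1` [set -1].

Let mplus i : measurable (plus i).
Proof. exact: measurable_funPTI. Qed.

Let mminus i : measurable (minus i).
Proof. exact: measurable_funPTI. Qed.

Let cyl (B : I -> set R) (s : seq I) : set T :=
  \bigcap_(i in [set` s]) (eps i @^-1` B i).

Let mcyl B s : (forall i, measurable (B i)) -> measurable (cyl B s).
Proof.
move=> mB; apply: fin_bigcap_measurable; first exact: finite_seq.
by move=> i _; exact: measurable_funPTI.
Qed.

(** Almost surely a function of the sign [eps i], with values [a i] and [c i]. Being built from
    indicators, its products integrate to probabilities of cylinders. *)
Let step (a c : I -> R) i w : R := a i * \1_(plus i) w + c i * \1_(minus i) w.

Let mstep a c i : measurable_fun [set: T] (step a c i).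
Proof.
by apply: measurable_funD; apply: measurable_funM => //;
  exact: measurable_indic.
Qed.

Let step_ge0 a c i w : 0 <= a i -> 0 <= c i -> 0 <= step a c i w.
Proof. by move=> a0 c0; rewrite addr_ge0 // mulr_ge0. Qed.

(** As [j] is not yet constrained, overriding [B] at [j] leaves the other constraints intact. *)
Let cyl_cons B s j (x : R) : j \notin s ->
  cyl B s `&` (eps j @^-1` [set x]) =
  cyl (fun i => if i == j then [set x] else B i) (j :: s).
Proof.
move=> js; apply/seteqP; split => w.
  move=> [ws wj] i /=; rewrite inE => /predU1P[->|si]; first by rewrite eqxx.
  by case: eqP => [->//|_]; exact: ws.
move=> wc; split; last by have /= := wc j; rewrite inE eqxx; exact.
move=> i /= si; have /= := wc i; rewrite inE si orbT.
case: eqP => [ij|_]; last exact.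
by move: si js; rewrite ij => ->.
Qed.

(* The induction peels factors off [s] and turns each of them into two
   constraints on the cylinder, to which independence applies in the end. *)
Lemma integral_prod_step (a c : I -> R) (s s' : seq I) (B : I -> set R) :
  (forall i, 0 <= a i) -> (forall i, 0 <= c i) ->
  (forall i, measurable (B i)) -> uniq (s ++ s') ->
  (\int[P]_(w in cyl B s') (\prod_(i <- s) step a c i w)%:E =
   (\prod_(i <- s) ((a i + c i) / 2))%:E *
   \prod_(i <- s') P (eps i @^-1` B i))%E.
Proof.
move=> a0 c0; elim: s s' B => [|j s IH] s' B mB.
  move=> /= us'; rewrite big_nil mul1e.
  under eq_integral do rewrite big_nil.
  rewrite integral_cst ?mul1e; last exact: mcyl.
  exact: heps.1.
move=> us; have : uniq (s ++ (j :: s')) by rewrite -cat1s uniq_catCA.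
move=> us2; have js' : j \notin s'.
  by move: us2; rewrite cat_uniq => /and3P[_ _ /=/andP[]].
pose g w : R := \prod_(i <- s) step a c i w.
have g0 w : 0 <= g w by apply: prodr_ge0 => i _; exact: step_ge0.
have mg : measurable_fun [set: T] g by apply: measurable_prod => i _.
have mD := mcyl s' mB.
have part (k x : R) : 0 <= k -> P (eps j @^-1` [set x]) = (2^-1)%:E ->
  (\int[P]_(w in cyl B s') (k * \1_(eps j @^-1` [set x]) w * g w)%:E =
   (\prod_(i <- s) ((a i + c i) / 2) * (k / 2))%:E *
   \prod_(i <- s') P (eps i @^-1` B i))%E.
  move=> k0 Px.
  (* The indicator is absorbed into the domain of integration, which is again a cylinder. *)
  transitivity (k%:E *
      \int[P]_(w in cyl B s' `&` (eps j @^-1` [set x])) (g w)%:E)%E.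
    rewrite integral_mkcondr -ge0_integralZl_EFin //.
    - apply: eq_integral => w _; rewrite patchE indicE.
      by case: (_ \in _); rewrite /= ?mulr1 ?mulr0 ?mul0r ?mule0.
    - by move=> w _; rewrite patchE; case: ifP; rewrite ?lee_fin ?g0.
    - apply: (measurable_funS measurableT) => //.
      apply/(measurable_restrictT _ _).1; first exact: measurable_funPTI.
      by apply/measurable_funTS/measurable_EFinP.
  rewrite cyl_cons // IH //; last by move=> i; case: ifP.
  rewrite big_cons eqxx Px.
  rewrite (eq_big_seq (fun i => P (eps i @^-1` B i))); last first.
    by move=> i si; case: eqP => // ij; move: si js'; rewrite ij => ->.
  by rewrite muleA muleA -!EFinM; congr (_ * _)%E; congr EFin; lra.
under eq_integral do rewrite big_cons /step mulrDl EFinD.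
rewrite ge0_integralD //.
- rewrite !part //; [|exact: (heps.2 j).2|exact: (heps.2 j).1].
  have Q0 : 0 <= \prod_(i <- s) ((a i + c i) / 2).
    by apply: prodr_ge0 => i _; rewrite divr_ge0 ?addr_ge0.
  rewrite big_cons -ge0_muleDl ?lee_fin ?mulr_ge0 // -EFinD.
  by congr (_%:E * _)%E; lra.
- by move=> w _; rewrite lee_fin (mulr_ge0 _ (g0 w)) // mulr_ge0.
- apply/measurable_funTS/measurable_EFinP; apply: measurable_funM => //.
  by apply: measurable_funM => //; exact: measurable_indic.
- by move=> w _; rewrite lee_fin (mulr_ge0 _ (g0 w)) // mulr_ge0.
- apply/measurable_funTS/measurable_EFinP; apply: measurable_funM => //.
  by apply: measurable_funM => //; exact: measurable_indic.
Qed.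

Let expectation_prod_step (a c : I -> R) (s : seq I) :
  (forall i, 0 <= a i) -> (forall i, 0 <= c i) -> uniq s ->
  'E_P[fun w => (\prod_(i <- s) step a c i w)%R]%E =
  (\prod_(i <- s) ((a i + c i) / 2))%:E.
Proof.
move=> a0 c0 us; have := @integral_prod_step a c s [::] (fun=> setT) a0 c0.
rewrite cats0 big_nil mule1 expectation.unlock => <- //.
by rewrite /cyl bigcapT // => i _; exact: preimage_setT.
Qed.

(** For each index the two disjoint events have total probability one; the countably many null sets
    are united through the coding of [I] by naturals. *)
Lemma ae_sign : {ae P, forall w, forall i, eps i w = 1 \/ eps i w = -1}.
Proof.
have sign i : {ae P, forall w, eps i w = 1 \/ eps i w = -1}.
  have mU : measurable (plus i `|` minus i) by exact: measurableU.
  exists (~` (plus i `|` minus i)); split; first exact: measurableC.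
    rewrite [LHS]probability_setC // (_ : P _ = 1%E) ?subee //.
    transitivity ((2^-1)%:E + (2^-1)%:E : \bar R)%E; last first.
      by rewrite -EFinD; congr EFin; lra.
    have [<- {2}<-] := heps.2 i; apply: measureU => //.
    apply/seteqP; split => // w []; rewrite /plus /minus /= => -> ?; lra.
  by move=> w /= nw [] ?; apply: nw; [left|right].
have : {ae P, forall w, forall n : nat,
    if pickle_inv n is Some i then eps i w = 1 \/ eps i w = -1 else True}.
  apply: ae_foralln => n; case: pickle_inv => [i|]; first exact: sign.
  exact: aeW.
apply: filterS => w ws i; have := ws (choice.pickle i).
by rewrite choice.pickleK_inv.
Qed.

(** Almost surely [e^Y] lies between [e^(-D F) * G F] and [e^(D F) * G F], where [D F] is the
    absolute tail outside [F] and [G F] has mean [C F], a product of hyperbolic cosines. Taking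
    logarithms of the means and letting [D F] tend to 0 gives the value. A general [Y] covers both
    [psi1] and [cumulant]. *)
Lemma lne_mgf (u : I -> R) (Y : T -> R) : l1 u ->
  measurable_fun [set: T] Y ->
  {ae P, forall w, sums_to (fun i => u i * eps i w) (Y w)} ->
  lne 'E_P[expR \o Y]%E = (rsum (fun i => lncosh (u i)))%:E.
Proof.
move=> u1 mY Ysum.
pose C (F : {fset I}) : R := \prod_(i <- F) coshR (u i).
pose D (F : {fset I}) : R := norm1 u - \sum_(i <- F) `|u i|.
pose G (F : {fset I}) w : R :=
  \prod_(i <- F) step (fun i => expR (u i)) (fun i => expR (- u i)) i w.
have C0 F : 0 < C F by apply: prodr_gt0 => i _; exact: coshR_gt0.
have G0 F w : 0 <= G F w.
  by apply: prodr_ge0 => i _; apply: step_ge0; exact: expR_ge0.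
have mG F : measurable_fun [set: T] (G F) by apply: measurable_prod => i _.
have EG (k : R) F : 0 <= k -> 'E_P[fun w => (k * G F w)%R]%E = (k * C F)%:E.
  move=> k0; rewrite expectation.unlock; under eq_integral do rewrite EFinM.
  rewrite ge0_integralZl_EFin //; last 2 first.
  - by move=> w _; rewrite lee_fin.
  - exact/measurable_EFinP.
  have := @expectation_prod_step (fun i => expR (u i)) (fun i => expR (- u i))
    F (fun i => expR_ge0 _) (fun i => expR_ge0 _) (fset_uniq F).
  by rewrite expectation.unlock => ->.
have Gexp : {ae P, forall w, forall F : {fset I},
    expR (- D F) * G F w <= expR (Y w) <= expR (D F) * G F w}.
  apply: filterS2 ae_sign Ysum => w ws Yw F.
  have -> : G F w = expR (\sum_(i <- F) u i * eps i w).
    rewrite expR_sum; apply: eq_bigr => i _; rewrite /step !indicE.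
    case: (ws i) => e1; rewrite e1.
      rewrite mem_set // memNset ?mulr1 ?mulr0 ?addr0 //.
      by rewrite /minus /= e1 => ?; lra.
    rewrite memNset ?mem_set ?mulr1 ?mulr0 ?add0r ?mulrN1 //.
    by rewrite /plus /= e1 => ?; lra.
  (* Signs preserve absolute values, so the tail bound [D F] does not depend on [w]. *)
  have normE i : `|u i * eps i w| = `|u i|.
    by case: (ws i) => ->; rewrite ?mulr1 ?mulrN1 ?normrN.
  have ue1 : l1 (fun i => u i * eps i w) by apply: l1_le u1 => i; rewrite normE.
  have := dist_rsum_fset F ue1; rewrite (rsum_sums_to ue1 Yw).
  rewrite /norm1 (funext normE) (eq_bigr _ (fun i _ => normE i)).
  rewrite -/(D F) ler_norml -!expRD !ler_expR => /andP[? ?].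
  by apply/andP; split; lra.
have mE : measurable_fun [set: T] (expR \o Y) by exact: measurableT_comp.
have lower F : ((expR (- D F) * C F)%:E <= 'E_P[expR \o Y])%E.
  rewrite -EG ?expR_ge0 //; apply: expectation_le => //.
  - exact: measurable_funM.
  - by move=> w; rewrite mulr_ge0 ?expR_ge0.
  - by move=> w; exact: expR_ge0.
  - by apply: filterS Gexp => w /(_ F)/andP[].
have upper F : ('E_P[expR \o Y] <= (expR (D F) * C F)%:E)%E.
  rewrite -EG ?expR_ge0 //; apply: expectation_le => //.
  - exact: measurable_funM.
  - by move=> w; exact: expR_ge0.
  - by move=> w; rewrite mulr_ge0 ?expR_ge0.
  - by apply: filterS Gexp => w /(_ F)/andP[].
(* The bounds for the empty set already make the expectation finite and positive, so its logarithm
   is an ordinary one. *)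
have := lower fset0; have := upper fset0.
case: ('E_P[expR \o Y])%E lower upper => [r| |] lower upper; last 2 first.
- by rewrite leye_eq.
- by rewrite leeNy_eq.
move=> _; rewrite lee_fin => r_ge.
have r0 : 0 < r by apply: lt_le_trans r_ge; rewrite mulr_gt0 ?expR_gt0.
rewrite lne_EFin //; congr EFin; apply/esym/rsum_sums_to.
  apply: l1_le u1 => i; rewrite ger0_norm ?lncosh_ge0 //; exact: lncosh_le.
have lnC F : ln (C F) = \sum_(i <- F) lncosh (u i).
  rewrite -[RHS]expRK expR_sum; congr ln; apply: eq_bigr => i _.
  by rewrite lnK // posrE coshR_gt0.
have near_ln (F : {fset I}) : `|\sum_(i <- F) lncosh (u i) - ln r| <= D F.
  have := lower F; have := upper F; rewrite !lee_fin.
  rewrite -ler_ln ?posrE ?mulr_gt0 ?expR_gt0 //.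
  rewrite -[in X in _ -> X]ler_ln ?posrE ?mulr_gt0 ?expR_gt0 //.
  rewrite !lnM ?posrE ?expR_gt0 // !expRK lnC ler_norml => ? ?.
  by apply/andP; split; lra.
move=> e e0.
have [F0 F0e] := sums_to_rsum (l1_norm u1) e0.
exists F0 => F /F0e; rewrite ler_norml => /andP[? _].
by apply: le_trans (near_ln F) _; rewrite /D /norm1; lra.
Qed.

Lemma bernoulli_series_sums_to (u : I -> R) : l1 u ->
  {ae P, forall w, sums_to (fun i => u i * eps i w) (bernoulli_series eps u w)}.
Proof.
move=> u1; apply: filterS ae_sign => w ws; apply: sums_to_rsum.
apply: l1_le u1 => i.
by case: (ws i) => ->; rewrite ?mulr1 ?mulrN1 ?normrN.
Qed.

Lemma measurable_bernoulli_series (u : I -> R) :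
  measurable_fun [set: T] (bernoulli_series eps u).
Proof.
by apply: measurable_rsum => i; apply: measurable_funM.
Qed.

Lemma psi1E (u : I -> R) : l1 u ->
  psi1 eps u = (rsum (fun i => lncosh (u i)))%:E.
Proof.
move=> u1; apply: lne_mgf => //; first exact: measurable_bernoulli_series.
exact: bernoulli_series_sums_to.
Qed.

Lemma cumulantE (t : I -> R) (s : R) : l1 t ->
  cumulant P (bernoulli_series eps t) s =
  (rsum (fun i => lncosh (s * t i)))%:E.
Proof.
move=> t1; rewrite /cumulant /mmt_gen_fun.
apply: (@lne_mgf (fun i => s * t i)); first exact: l1Z.
  by apply: measurable_funM => //; exact: measurable_bernoulli_series.
apply: filterS (bernoulli_series_sums_to t1) => w /(sums_toZ s).
rewrite mulrC; congr sums_to; apply/funext => i; exact: mulrA.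
Qed.

End bernoulli.

(** * The pairing, and the range of [s |-> sum_i t_i tanh (s t_i)] *)

Section duality_pairing.
Context {R : realType} {I : choiceType}.
Implicit Types u t b : I -> R.

Lemma linfty_bound b : linfty b -> exists M, forall i, `|b i| <= M.
Proof.
move=> [M [_ bM]]; exists (M + 1) => i; apply: (bM (M + 1)) => //.
by rewrite ltrDl.
Qed.

Lemma linfty_le1 b : (forall i, `|b i| <= 1) -> linfty b.
Proof.
move=> b1; exists 1; split; first exact: num_real.
by move=> M M1 i _; apply: le_trans (b1 i) (ltW M1).
Qed.

Lemma l1M u b : l1 u -> linfty b -> l1 (fun i => u i * b i).
Proof.
move=> u1 /linfty_bound[M bM]; apply: l1_le (l1Z M u1) => i.
rewrite !normrM mulrC ler_wpM2r //.
exact: le_trans (bM i) (ler_norm M).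
Qed.

Lemma l1_lncosh u : l1 u -> l1 (fun i => lncosh (u i)).
Proof.
by apply: l1_le => i; rewrite ger0_norm ?lncosh_ge0 // lncosh_le.
Qed.

Lemma l1_mul_tanhR u t : l1 u -> l1 (fun i => u i * tanhR (t i)).
Proof.
move=> u1; apply: l1M => //; apply: linfty_le1 => i.
exact/ltW/tanhR_lt1.
Qed.

Lemma norm1_ge t i : l1 t -> `|t i| <= norm1 t.
Proof.
move=> /l1_norm t1; have := sum_fset_le_rsum [fset i]%fset t1.
by rewrite big_seq_fset1; exact.
Qed.

(** Each term changes by at most [4 |t_i|^2 |x - y|]; one factor [|t_i|] is bounded by the norm and
    the other is summed. *)
Lemma rsum_tanhR_lipschitz t (x y : R) : l1 t ->
  `|rsum (fun i => t i * tanhR (x * t i)) -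
    rsum (fun i => t i * tanhR (y * t i))| <= 4 * norm1 t ^+ 2 * `|x - y|.
Proof.
move=> t1; rewrite -rsumB; [|exact: l1_mul_tanhR|exact: l1_mul_tanhR].
apply: le_trans (ler_norm_rsum _) _.
  by apply: l1B; exact: l1_mul_tanhR.
rewrite (_ : _ * `|x - y| = rsum (fun i => (4 * norm1 t * `|x - y|) * `|t i|)).
  apply: ler_rsum.
  - by apply: l1_norm; apply: l1B; exact: l1_mul_tanhR.
  - exact/l1Z/l1_norm.
  move=> i; rewrite -mulrBr normrM.
  apply: (le_trans (ler_wpM2l (normr_ge0 _) (tanhR_lipschitz _ _))).
  rewrite -mulrBl normrM.
  have := norm1_ge i t1; have := normr_ge0 (t i); have := normr_ge0 (x - y).
  by move=> xy0 t0 /(ler_wpM2r (mulr_ge0 xy0 t0)) ?; lra.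
rewrite rsumZ; last exact: l1_norm.
by rewrite -/(norm1 t); lra.
Qed.

Lemma continuous_rsum_tanhR t : l1 t ->
  continuous (fun s : R => rsum (fun i => t i * tanhR (s * t i))).
Proof.
move=> t1 x; apply/cvgrPdist_le => e e0.
pose K := 4 * norm1 t ^+ 2 + 1.
have K0 : 0 < K by rewrite ltr_wpDl // mulr_ge0 // sqr_ge0.
near=> y; apply: (le_trans (rsum_tanhR_lipschitz _ _ t1)).
apply: (@le_trans _ _ (K * `|x - y|)).
  by rewrite ler_wpM2r // lerDl.
rewrite mulrC -ler_pdivlMr //; near: y.
by apply: cvgr_dist_le => //; exact: divr_gt0.
Unshelve. all: by end_near. Qed.

(** The function is odd and continuous, so once [f s >= |alpha|] for some [s > 0], the intermediate
    value theorem on [[-s, s]] applies. *)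
Lemma rsum_tanhR_surj t (alpha : R) : l1 t -> - norm1 t < alpha < norm1 t ->
  exists s, rsum (fun i => t i * tanhR (s * t i)) = alpha.
Proof.
move=> t1; rewrite -ltr_norml => alphat.
pose f s := rsum (fun i => t i * tanhR (s * t i)).
have e0 : 0 < (norm1 t - `|alpha|) / 2 by rewrite divr_gt0 // subr_gt0.
have [F tF] := rsum_approx (l1_norm t1) e0.
set e := (_ - _) / 2 in e0 tF.
pose n : R := (size F).+1%:R.
have n0 : 0 < n by rewrite ltr0n.
(* Half of the gap [2 e = ||t||_1 - |alpha|] pays for the indices outside [F], the other half for
   the loss [1 / s] at each index of [F]. The successor in [n] keeps [s] positive when [F] is
   empty. *)
pose s := n / e.
have s0 : 0 < s by rewrite divr_gt0.
have fs : `|alpha| <= f s.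
  apply: (@le_trans _ _ (\sum_(i <- F) t i * tanhR (s * t i))); last first.
    apply: sum_fset_le_rsum; first exact: l1_mul_tanhR.
    move=> i; rewrite -(pmulr_rge0 _ s0) mulrA mul_tanhR_ge0 //.
  apply: (@le_trans _ _ (\sum_(i <- F) (`|t i| - s^-1))); last first.
    by apply: ler_sum => i _; exact: mul_tanhR_ge.
  rewrite sumrB big_const_seq count_predT iter_addr_0 -mulr_natl.
  have : (size F)%:R * s^-1 <= e.
    rewrite invf_div mulrA ler_pdivrMr // mulrC ler_pM2l //.
    by rewrite ler_nat.
  by move: tF; rewrite -/(norm1 t) /e => ? ?; lra.
have fN x : f (- x) = - f x.
  rewrite /f -[RHS]mulN1r -rsumZ; last exact: l1_mul_tanhR.
  by congr rsum; apply/funext => i; rewrite mulNr tanhRN mulrN mulN1r.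
have [| | |s' _ <-] := @IVT R f (- s) s alpha; last by exists s'.
- by lra.
- by apply: continuous_subspaceT; exact: continuous_rsum_tanhR.
- have := ler_norm alpha; have := ler_norm (- alpha); rewrite normrN => ? ?.
  by rewrite fN ge_min le_max; apply/andP; split; apply/orP; [left|right]; lra.
Qed.

End duality_pairing.

(** * The conjugate of [psi1] and its duality with the Cramér transform *)

Section cramer_bernoulli.
Context {R : realType} {d : measure_display} {T : measurableType d}.
Context {P : probability T R} {I : countType} {eps : I -> {RV P >-> R}}.
Hypothesis heps : bernoulli_sequence eps.
Implicit Types (b u t : I -> R) (F : {fset I}).

(** Truncating [x] to [F] gives an admissible [l1] family, and [lncosh 0 = 0] removes the other
    coordinates. Lower bounds can thus be chosen coordinatewise. *)
Lemma psi1_conj_ge_fin b (x : I -> R) F :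
  ((\sum_(i <- F) (x i * b i - lncosh (x i)))%:E <= psi1_conj eps b)%E.
Proof.
pose u i := if i \in F then x i else 0.
have u1 : l1 u by apply: (@l1_fin _ _ _ F) => i /negbTE; rewrite /u => ->.
apply: ereal_sup_ubound; exists u => //.
rewrite psi1E // /pairing -EFinB.
rewrite (@rsum_fin _ _ _ F) => [|i /negbTE iF]; last by rewrite /u iF mul0r.
rewrite (@rsum_fin _ _ (fun i => lncosh (u i)) F); last first.
  move=> i /negbTE iF; by rewrite /u iF lncosh0.
rewrite -sumrB; congr EFin; apply: eq_big_seq => i iF.
by rewrite /u iF.
Qed.

Lemma entropy_termE (x : R) : `|x| <= 1 -> entropy_term x = (entropy x)%:E.
Proof. by rewrite /entropy_term => ->. Qed.

Lemma psi1_conjE b : linfty b ->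
  psi1_conj eps b =
  ((2^-1)%:E * \esum_(i in [set: I]) entropy_term (b i))%E.
Proof.
move=> bb; have [b1|] := pselect (forall i, `|b i| <= 1); last first.
  move=> /existsNP[i /negP]; rewrite -ltNge => bi.
  have -> : (\esum_(i in [set: I]) entropy_term (b i) = +oo)%E.
    apply/eqP; rewrite -leye_eq; apply: esum_ge; exists [set i].
      by split => //; exact: finite_set1.
    by rewrite fsbig_set1 /entropy_term ifN // -ltNge.
  rewrite gt0_muley ?lte_fin ?invr_gt0 //; apply/eqyP => A A0.
  (* Testing with [s b_i] in the single coordinate [i] gives at least [s k], which is unbounded in
     [s]. *)
  pose k := `|b i| * (`|b i| - 1).
  have k0 : 0 < k by rewrite mulr_gt0 ?subr_gt0 // (lt_trans _ bi).
  pose s := A / k; have s0 : 0 <= s by rewrite divr_ge0 // ltW.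
  apply: le_trans (psi1_conj_ge_fin b (fun=> s * b i) [fset i]%fset).
  rewrite big_seq_fset1 lee_fin.
  have : lncosh (s * b i) <= s * `|b i|.
    by apply: le_trans (lncosh_le _) _; rewrite normrM (ger0_norm s0).
  have -> : s * b i * b i = s * `|b i| * `|b i|.
    by rewrite -!mulrA -!expr2 real_normK ?num_real.
  have : A = s * k by rewrite divfK ?gt_eqF.
  by rewrite /k => -> ?; lra.
have term_ge0 i : 0 <= entropy (b i) by exact: entropy_ge0.
rewrite (eq_esum (fun i _ => entropy_termE (b1 i))).
apply/eqP; rewrite eq_le; apply/andP; split.
  (* Upper bound: reducing to a finite sum up to [e] allows termwise use of [lncosh_entropy] even if
     the entropy series diverges. *)
  apply: ge_ereal_sup => _ [u u1 <-]; apply/lee_addgt0Pr => e e0.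
  have ub1 := l1M u1 bb; have lu1 := l1_lncosh u1.
  rewrite psi1E // -EFinB /pairing -rsumB //.
  have [F uF] := rsum_approx (l1B ub1 lu1) e0.
  apply: (@le_trans _ _ (2^-1 * \sum_(i <- F) entropy (b i) + e)%:E).
    rewrite lee_fin; apply: le_trans uF _; rewrite lerD2r mulr_sumr.
    by apply: ler_sum => i _; rewrite [leRHS]mulrC; exact: lncosh_entropy.
  rewrite EFinD EFinM leeD2r // lee_pmul2l ?lte_fin ?invr_gt0 //.
  exact: sum_fset_le_esum.
(* Lower bound: on each finite set, near-optimal coordinates are chosen independently, with total
   error at most [e]. *)
rewrite lee_pdivrMl //; apply: ge_ereal_sup => _ [A [finA _] <-].
rewrite fsbig_finite //= sumEFin -lee_pdivrMl //.
apply/lee_addgt0Pr => e e0; set F := fset_set A.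
pose e' := e / (size F).+1%:R.
have e'0 : 0 < e' by rewrite divr_gt0.
have /choice[x xb] i := entropy_approx (b1 i) e'0.
rewrite -leeBlDr //; apply: le_trans (psi1_conj_ge_fin b x F).
rewrite -EFinM -EFinB lee_fin.
apply: (@le_trans _ _ (\sum_(i <- F) (entropy (b i) / 2 - e'))); last first.
  by apply: ler_sum => i _; exact: xb.
rewrite sumrB -mulr_suml mulrC lerB // big_const_seq count_predT iter_addr_0.
rewrite -mulr_natl mulrCA ger_pMr // ler_pdivrMr // mul1r ler_nat.
exact: leqnSn.
Qed.

(** Weak duality: the left side is the supremum defining [psi1_conj] restricted to the line of
    families [s t]. *)
Lemma cramer_le_psi1_conj t b : l1 t -> linfty b ->
  (cramer P (bernoulli_series eps t) (pairing t b) <= psi1_conj eps b)%E.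
Proof.
move=> t1 bb; apply: ge_ereal_sup => _ [s _ <-].
apply: ereal_sup_ubound; exists (fun i => s * t i); first exact: l1Z.
rewrite cumulantE // psi1E //; last exact: l1Z.
congr (_%:E - _)%E; rewrite /pairing mulrC -rsumZ; last exact: l1M.
by congr rsum; apply/funext => i; rewrite mulrA.
Qed.

(** At this [b], every coordinate of a competing family is bounded by the value at [s t_i], by
    [lncosh_entropy] and its equality case. The supremum is therefore attained on the line of
    multiples of [t]. *)
Lemma psi1_conj_tanhR_le t (s : R) : l1 t ->
  (psi1_conj eps (fun i => tanhR (s * t i)) <=
   (s * pairing t (fun i => tanhR (s * t i)) -
    rsum (fun i => lncosh (s * t i)))%:E)%E.
Proof.
move=> t1; have st1 := l1Z s t1.
set b := fun i => tanhR (s * t i).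
have b1 i : `|b i| <= 1 by exact/ltW/tanhR_lt1.
have bb : linfty b by exact: linfty_le1.
apply: ge_ereal_sup => _ [u u1 <-]; rewrite psi1E // -EFinB lee_fin.
rewrite /pairing -rsumZ; last exact: l1M.
rewrite -!rsumB; [|exact/l1Z/l1M|exact: l1_lncosh|exact: l1M|exact: l1_lncosh].
apply: ler_rsum.
- by apply: l1B; [exact: l1M|exact: l1_lncosh].
- by apply: l1B; [exact/l1Z/l1M|exact: l1_lncosh].
move=> i; rewrite mulrA -entropy_tanhR; exact: lncosh_entropy.
Qed.

(** The test point is [r] or [-r], with the sign of [alpha]; [lncosh] is even. It reduces the study
    of [|alpha| >= ||t||_1] to large [r]. *)
Lemma cramer_ge t (alpha r : R) : l1 t -> 0 <= r ->
  ((r * `|alpha| - rsum (fun i => lncosh (r * `|t i|)))%:E <=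
   cramer P (bernoulli_series eps t) alpha)%E.
Proof.
move=> t1 r0; pose s := if 0 <= alpha then r else - r.
apply: ereal_sup_ubound; exists s => //.
rewrite cumulantE // -EFinB; congr EFin; congr (_ - _).
  by rewrite /s; case: ger0P => _; rewrite ?mulrN mulrC ?mulNr ?mulrN.
congr rsum; apply/funext => i; rewrite -[LHS]lncosh_norm -[RHS]lncosh_norm.
rewrite !normrM normr_id.
by rewrite /s; case: ifP; rewrite ?normrN.
Qed.

(** Since [lncosh x <= |x|], the lower bound grows at least like [r (|alpha| - ||t||_1)]. *)
Lemma cramer_outside t (alpha : R) : l1 t -> norm1 t < `|alpha| ->
  cramer P (bernoulli_series eps t) alpha = +oo%E.
Proof.
move=> t1 ta; apply/eqyP => A A0; pose k := `|alpha| - norm1 t.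
have k0 : 0 < k by rewrite subr_gt0.
pose r := A / k; have r0 : 0 <= r by rewrite divr_ge0 // ltW.
have Ar : A = r * k by rewrite divfK ?gt_eqF.
apply: le_trans (cramer_ge alpha t1 r0); rewrite lee_fin.
have rt1 := l1Z r (l1_norm t1).
have : rsum (fun i => lncosh (r * `|t i|)) <= r * norm1 t.
  rewrite -rsumZ; last exact: l1_norm.
  apply: ler_rsum => // [|i]; first exact: l1_lncosh.
  by apply: le_trans (lncosh_le _) _; rewrite ger0_norm // mulr_ge0.
by rewrite Ar /k => ?; lra.
Qed.

(* Once [r |t i| >= 2], a coordinate contributes to [r ||t||_1 - psi_t r] a
   fixed amount, so infinitely many nonzero coordinates make it unbounded. *)
Lemma cramer_boundary t (alpha : R) : l1 t -> `|alpha| = norm1 t ->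
  infinite_set [set i | t i != 0] ->
  cramer P (bernoulli_series eps t) alpha = +oo%E.
Proof.
move=> t1 ta tinf; apply/eqyP => A A0.
(* Each chosen coordinate will contribute at least [1/4], so more than [4 A] of them exceed [A]. *)
pose n := (Num.truncn (4 * A)).+1.
have [F Ft nF] := infinite_set_fset n tinf.
(* The sum stands in for a maximum: it dominates each [2 / |t_i|] with [i] in [F]. *)
pose r := \sum_(i <- F) 2 / `|t i|.
have r0 : 0 <= r by apply: sumr_ge0 => i _; exact: divr_ge0.
have rF i : i \in F -> 2 <= r * `|t i|.
  move=> iF; have t0 : 0 < `|t i| by rewrite normr_gt0; exact: Ft.
  rewrite -ler_pdivrMr // /r (big_fsetD1 i) //= lerDl.
  by apply: sumr_ge0 => j _; exact: divr_ge0.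
apply: le_trans (cramer_ge alpha t1 r0); rewrite lee_fin ta.
have rt1 := l1Z r (l1_norm t1).
rewrite -rsumZ -?rsumB //; [|exact: l1_lncosh|exact: l1_norm].
have term_ge0 i : 0 <= r * `|t i| - lncosh (r * `|t i|).
  rewrite subr_ge0; apply: le_trans (lncosh_le _) _.
  by rewrite ger0_norm // mulr_ge0.
apply: le_trans (sum_fset_le_rsum F (l1B rt1 (l1_lncosh rt1)) term_ge0).
(* For [r |t_i| >= 2] the contribution is at least [ln 2 - 1/5 >= 1/2 - 1/5], above [1/4]. *)
apply: (@le_trans _ _ (\sum_(i <- F) 4^-1)); last first.
  rewrite [leLHS]big_seq [leRHS]big_seq; apply: ler_sum => i iF.
  have := sub_lncosh_ge (le_trans (ler0n R 2) (rF i iF)).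
  have : (1 + 2 * (r * `|t i|))^-1 <= 5^-1.
    by rewrite lef_pV2 ?posrE //; have := rF i iF; lra.
  by have := @ln2_ge R; lra.
rewrite big_const_seq count_predT iter_addr_0 -mulr_natl.
have : n%:R <= (size F)%:R :> R by rewrite ler_nat.
have : 4 * A < n%:R by exact: truncnS_gt.
by move=> ? ?; lra.
Qed.

End cramer_bernoulli.

Theorem theorem1p1 (R : realType) (d : measure_display) (T : measurableType d)
    (P : probability T R) (I : countType) (eps : I -> {RV P >-> R})
    (t : I -> R) (heps : bernoulli_sequence eps) (ht : l1 t) :
  [/\ forall alpha : R, - norm1 t < alpha < norm1 t ->
        is_minimum
          [set psi1_conj eps b | b in
             [set b | effective_domain linfty (psi1_conj eps) b /\
                      pairing t b = alpha]]
          (cramer P (bernoulli_series eps t) alpha),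
      forall alpha : R, ~~ (- norm1 t < alpha < norm1 t) ->
        (`|alpha| = norm1 t -> infinite_set [set i | t i != 0]) ->
        cramer P (bernoulli_series eps t) alpha = +oo%E
    & forall b : I -> R, linfty b ->
        psi1_conj eps b =
          ((2^-1)%:E * \esum_(i in [set: I]) entropy_term (b i))%E].
Proof.
split=> [alpha alphat|alpha|b]; last exact: psi1_conjE.
  have [s s_alpha] := rsum_tanhR_surj ht alphat.
  set b := fun i => tanhR (s * t i).
  have bb : linfty b by apply: linfty_le1 => i; exact/ltW/tanhR_lt1.
  have b_alpha : pairing t b = alpha := s_alpha.
  have psi1b := psi1_conj_tanhR_le heps s ht; rewrite -/b b_alpha in psi1b.
  split; last by move=> _ [c [[cb _] <-] <-]; exact: cramer_le_psi1_conj.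
  (* The real upper bound [psi1b] also places [b] in the effective domain. *)
  exists b; first by split=> //; split=> //; exact: le_lt_trans psi1b (ltry _).
  apply/eqP; rewrite eq_le -{2}b_alpha cramer_le_psi1_conj // andbT.
  (* The bound [psi1b] is the value at [s] of the expression whose supremum is the Cramér transform
     at [alpha]. *)
  apply: le_trans psi1b _; apply: ereal_sup_ubound; exists s => //.
  by rewrite cumulantE // -EFinB mulrC.
(* At [|alpha| = ||t||_1] infinite support forces divergence, whereas [n] nonzero coordinates would
   give the finite value [n ln 2]; beyond it, linear growth decides. *)
rewrite -ltr_norml -leNgt le_eqVlt => /predU1P[/esym ta|ta].
  by move=> /(_ ta); exact: cramer_boundary.
by move=> _; exact: cramer_outside.
Qed.
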